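(* Let $N \ge 2$ and let $\mathbf{B} \in \mathbb{R}^{N\times N}$ be the symmetric tridiagonal matrix, with rows and columns indexed by $0,\ldots,N-1$, whose diagonal is $(-1,-2,-2,\ldots,-2,-1)$ (first and last diagonal entries $-1$, all other diagonal entries $-2$), whose entries at positions $(j,k)$ with $|j-k|=1$ are $1$, and whose other entries are $0$. Then the Moore-Penrose inverse of $\mathbf{B}$ is a symmetric matrix $\mathbf{B}^+ = (b_{j,k}^+)_{j,k=0}^{N-1}$ with $$b_{j,k}^+ = -\frac{(N-1)(2N-1)}{6N} + j - \frac{j(j+1)}{2N} - \frac{k(k+1)}{2N}$$ for $j \ge k$.
   Context: The Moore-Penrose inverse of a real square matrix $\mathbf{L}$ is the unique matrix $\mathbf{L}^+$ such that $\mathbf{L}\mathbf{L}^+\mathbf{L} = \mathbf{L}$, $\mathbf{L}^+\mathbf{L}\mathbf{L}^+ = \mathbf{L}^+$, and both $\mathbf{L}\mathbf{L}^+$ and $\mathbf{L}^+\mathbf{L}$ are symmetric. *)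

(* Defs.v *)
From mathcomp Require Import all_boot all_order all_algebra.
From mathcomp Require Import reals.

Set Implicit Arguments.
Unset Strict Implicit.
Unset Printing Implicit Defensive.

Import Order.TTheory GRing.Theory Num.Theory.
Local Open Scope ring_scope.

Definition is_mpinv (R : nzRingType) (n : nat) (L X : 'M[R]_n) : bool :=
  [&& L *m X *m L == L,
      X *m L *m X == X,
      (L *m X)^T == L *m X
    & (X *m L)^T == X *m L].

Lemma row_free_gram (R : realFieldType) (m n : nat) (A : 'M[R]_(m, n)) :
  row_free A -> A *m A^T \in unitmx.
Proof.
move=> Afree; rewrite -row_free_unit -kermx_eq0; apply/rowV0P => u /sub_kermxP.
rewrite mulmxA => uAA0; apply: (row_free_inj Afree); rewrite /= mul0mx.
have: (u *m A *m (u *m A)^T) 0 0 = 0 by rewrite trmx_mul mulmxA uAA0 mul0mx mxE.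
rewrite mxE => /psumr_eq0P sq0; apply/rowP => j; rewrite [RHS]mxE.
have /sq0 /(_ j isT) : forall i, true -> 0 <= (u *m A) 0 i * (u *m A)^T i 0.
  by move=> i _; rewrite [X in _ * X]mxE -expr2 sqr_ge0.
by rewrite [X in _ * X]mxE => /eqP; rewrite -expr2 sqrf_eq0 => /eqP.
Qed.

(* With the rank factorization L = C *m F, the Moore-Penrose inverse is
   F^T (F F^T)^-1 (C^T C)^-1 C^T. *)
Lemma mpinv_exists (R : realFieldType) (n : nat) (L : 'M[R]_n) :
  exists X : 'M[R]_n, is_mpinv L X.
Proof.
set C := col_base L; set F := row_base L.
have LE : L = C *m F by rewrite mulmx_base.
have Fu : F *m F^T \in unitmx by rewrite row_free_gram ?row_base_free.
have Cu : C^T *m C \in unitmx.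
  rewrite -{2}[C]trmxK row_free_gram // /row_free mxrank_tr.
  exact: col_base_full.
move: C F LE Fu Cu; move: (\rank L) => r C F LE Fu Cu.
set P := invmx (F *m F^T); set Q := invmx (C^T *m C).
have PT : P^T = P by rewrite /P trmx_inv trmx_mul trmxK.
have QT : Q^T = Q by rewrite /Q trmx_inv trmx_mul trmxK.
have LX : L *m (F^T *m P *m Q *m C^T) = C *m Q *m C^T.
  by rewrite LE !mulmxA -(mulmxA C F) -(mulmxA C (_ *m _)) mulmxV // mulmx1.
have XL : F^T *m P *m Q *m C^T *m L = F^T *m P *m F.
  by rewrite LE !mulmxA -(mulmxA _ C^T C) -(mulmxA _ Q) mulVmx // mulmx1.
exists (F^T *m P *m Q *m C^T); rewrite /is_mpinv LX XL; apply/and4P; split.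
- by rewrite {1}LE !mulmxA -(mulmxA _ C^T C) -(mulmxA _ Q) mulVmx // mulmx1 -LE.
- by rewrite !mulmxA -(mulmxA _ F F^T) -(mulmxA _ P (F *m _)) mulVmx // mulmx1.
- by rewrite !trmx_mul trmxK QT mulmxA.
- by rewrite !trmx_mul trmxK PT mulmxA.
Qed.

Lemma mpinv_unique (R : realFieldType) (n : nat) (L X Y : 'M[R]_n) :
  is_mpinv L X -> is_mpinv L Y -> X = Y.
Proof.
case/and4P=> /eqP X1 /eqP X2 /eqP X3 /eqP X4.
case/and4P=> /eqP Y1 /eqP Y2 /eqP Y3 /eqP Y4.
have LXY : L *m X = L *m Y.
  by rewrite -X3 -{1}Y1 -(mulmxA _ L X) trmx_mul X3 Y3 mulmxA X1.
have XLY : X *m L = Y *m L.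
  by rewrite -X4 -{1}Y1 -(mulmxA L) (mulmxA X L) trmx_mul Y4 X4 -mulmxA (mulmxA L) X1.
by rewrite -X2 XLY -mulmxA LXY mulmxA Y2.
Qed.

Definition mpinv (R : realFieldType) (n : nat) (L : 'M[R]_n) : 'M[R]_n :=
  xchoose (mpinv_exists L).

Lemma mpinvP (R : realFieldType) (n : nat) (L : 'M[R]_n) :
  is_mpinv L (mpinv L).
Proof. exact: xchooseP. Qed.

Definition tridiagB (R : realFieldType) (N : nat) : 'M[R]_N :=
  \matrix_(j < N, k < N)
    if j == k then
      if (j == 0%N :> nat) || (j == N.-1 :> nat) then -1 else -2
    else if (j == k.+1 :> nat) || (k == j.+1 :> nat) then 1
    else 0.

(* Main.v *)
Require Import Defs.
From mathcomp Require Import all_boot all_order all_algebra.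
From mathcomp Require Import reals.
From mathcomp Require Import zify ring.

Import Order.TTheory GRing.Theory Num.Theory.
Local Open Scope ring_scope.

(** The matrix B is the discrete Neumann Laplacian, so its kernel is spanned by
    the constants.  For the candidate G of the theorem one checks that
    B G = 1 - J / N and J G = 0, where J is the all-ones matrix; since B and G
    are symmetric and B J = 0, the four Penrose equations follow.  Writing
    G j k = c + max(j,k) - q(j) - q(k) with q(j) = j(j+1)/(2N), the increment
    of G in j is [k <= j] - (j+1)/N, which vanishes at j = N-1: hence the
    boundary rows of B need no separate treatment. *)

(** Transposing [L *m X = 1%:M - P] gives the same value for [X *m L]. Left multiplication by it
    fixes [L] and [X], since [P] annihilates both. *)
Lemma is_mpinv_sym (R : realFieldType) (n : nat) (L X P : 'M[R]_n) :
  L^T = L -> X^T = X -> L *m X = 1%:M - P ->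
  P^T = P -> P *m L = 0 -> P *m X = 0 -> is_mpinv L X.
Proof.
move=> LT XT LX PT PL PX.
have XL : X *m L = 1%:M - P.
  by rewrite -[LHS]trmxK trmx_mul LT XT LX linearB /= PT trmx1.
rewrite /is_mpinv {1}LX {1}XL LX XL !mulmxBl PL PX !subr0 !mul1mx.
by rewrite linearB /= PT trmx1 !eqxx.
Qed.

Lemma sum_ord_delta (R : nzRingType) (n a : nat) (v : nat -> R) :
  \sum_(k < n) (k == a :> nat)%:R * v k = (a < n)%:R * v a.
Proof.
case: ltnP => [an|na].
  rewrite (bigD1 (Ordinal an)) //= eqxx big1 ?addr0 // => k.
  by rewrite -val_eqE /= => /negPf ->; rewrite mul0r.
rewrite big1 ?mul0r // => k _.
by rewrite ltn_eqF ?mul0r // (leq_trans (ltn_ord k)).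
Qed.

Section Laplacian.
Context {R : realFieldType} (N : nat).

Lemma tridiagB_sym : (tridiagB R N)^T = tridiagB R N.
Proof.
apply/matrixP => i j; rewrite !mxE; have [-> //|ij] := eqVneq i j.
by rewrite orbC.
Qed.

Hypothesis hN : (2 <= N)%N.

(** Row [j] is a forward difference minus a backward one, each switched off where it would leave the
    range; for [k == j.+1] the bound [k < N] already does this. *)
Lemma tridiagBE (j k : 'I_N) :
  tridiagB R N j k =
    (k == j.+1 :> nat)%:R - (j.+1 < N)%:R * (k == j :> nat)%:R
    + ((0 < j)%N%:R * (k == j.-1 :> nat)%:R - (0 < j)%N%:R * (k == j :> nat)%:R).
Proof.
rewrite mxE -(inj_eq val_inj) /=; have := ltn_ord j; have := ltn_ord k.
move: (nat_of_ord j) (nat_of_ord k) => {}j {}k kN jN.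
have [->|jk] := eqVneq j k.
  have -> : (k == k.+1) = false by lia.
  have -> : (k.+1 < N)%N = (k != N.-1) by lia.
  have -> : (0 < k)%N = (k != 0%N) by lia.
  have [->|k0] := eqVneq k 0%N.
    have -> : (0%N == N.-1) = false by lia.
    by rewrite /=; ring.
  have -> : (k == k.-1) = false by lia.
  by case: (k == N.-1) => /=; ring.
have -> : (0 < j)%N%:R * (k == j.-1)%:R = (j == k.+1)%:R :> R.
  by rewrite -natrM mulnb; congr (nat_of_bool _)%:R; lia.
have [->|_] := eqVneq j k.+1; last by case: (k == j.+1) => /=; ring.
have -> : (k == k.+2) = false by lia.
by rewrite /=; ring.
Qed.

Lemma tridiagB_apply (v : nat -> R) (j : 'I_N) :
  \sum_(k < N) tridiagB R N j k * v k =
    (j.+1 < N)%:R * (v j.+1 - v j) - (0 < j)%N%:R * (v j - v j.-1).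
Proof.
under eq_bigr do rewrite tridiagBE mulrDl !mulrBl -!mulrA.
rewrite big_split !sumrB -!mulr_sumr !sum_ord_delta ltn_ord.
by rewrite (leq_ltn_trans (leq_pred j) (ltn_ord j)) /=; ring.
Qed.

(** Writing [maxn j k] for [j] extends the formula from [k <= j] to both triangles and makes it
    symmetric. *)
Definition neumann_green (k j : nat) : R :=
  - ((N%:R - 1) * (2 * N%:R - 1) / (6 * N%:R)) + (maxn j k)%:R
  - j%:R * (j%:R + 1) / (2 * N%:R) - k%:R * (k%:R + 1) / (2 * N%:R).

Lemma neumann_greenC (k j : nat) : neumann_green k j = neumann_green j k.
Proof. by rewrite /neumann_green maxnC addrAC. Qed.

Let N_neq0 : N%:R != 0 :> R.
Proof. by rewrite pnatr_eq0; lia. Qed.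

Lemma neumann_green_step (k j : nat) :
  neumann_green k j.+1 - neumann_green k j = (k <= j)%N%:R - j.+1%:R / N%:R.
Proof.
rewrite /neumann_green.
have -> : maxn j.+1 k = (maxn j k + (k <= j))%N by lia.
by rewrite natrD -[j.+1%:R]natr1; field.
Qed.

Lemma tridiagB_green (j k : 'I_N) :
  \sum_(l < N) tridiagB R N j l * neumann_green k l = (j == k)%:R - N%:R^-1.
Proof.
rewrite tridiagB_apply neumann_green_step.
have -> : (j.+1 < N)%:R * ((k <= j)%N%:R - j.+1%:R / N%:R)
    = (k <= j)%N%:R - j.+1%:R / N%:R :> R.
  case: ltnP => [_|Nj]; first by rewrite mul1r.
  have jN : j.+1 = N by apply/eqP; rewrite eqn_leq ltn_ord.
  by rewrite -ltnS jN ltn_ord divff // subrr mulr0.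
have -> : (0 < j)%N%:R * (neumann_green k j - neumann_green k j.-1)
    = (k < j)%N%:R - j%:R / N%:R.
  case: (nat_of_ord j) => [|i]; first by rewrite !mul0r subrr.
  by rewrite mul1r neumann_green_step.
(* The two increments differ by the indicator of [j = k] minus [(j + 1) / N - j / N = 1 / N]. *)
have -> : (k <= j)%N = (j == k :> nat) || (k < j)%N by lia.
rewrite -(inj_eq val_inj j k) /= -[j.+1%:R]natr1.
case: ltnP => kj; rewrite ?orbT ?orbF /=; last by field.
by rewrite gtn_eqF //=; field.
Qed.

Lemma sum_maxn (k n : nat) : (k <= n)%N ->
  \sum_(j < n) (maxn j k)%:R =
    (n%:R * (n%:R - 1) + k%:R * (k%:R + 1)) / 2 :> R.
Proof.
(* Induction on [n - k]: in the base case [n = k] every maximum is [k], and each later term is its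
   own index. *)
move/subnKC <-; elim: (n - k)%N => [|m IH].
  rewrite addn0 (eq_bigr (fun=> k%:R)) => [|j _].
    by rewrite sumr_const card_ord -mulr_natr; field.
  by rewrite (maxn_idPr (ltnW (ltn_ord j))).
rewrite addnS big_ord_recr /= IH (maxn_idPl (leq_addr _ _)) -natr1.
by field.
Qed.

Lemma sum_pronic (n : nat) :
  \sum_(j < n) j%:R * (j%:R + 1) = (n%:R - 1) * n%:R * (n%:R + 1) / 3 :> R.
Proof.
elim: n => [|n IH]; first by rewrite big_ord0 mulr0 !mul0r.
by rewrite big_ord_recr /= IH -natr1; field.
Qed.

(** This determines the additive constant: the terms in [k] cancel, leaving [N * (N - 1) / 2 - (N ^
    2 - 1) / 6 - (N - 1) * (2 * N - 1) / 6 = 0]. *)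
Lemma sum_neumann_green (k : 'I_N) : \sum_(j < N) neumann_green k j = 0.
Proof.
rewrite /neumann_green !sumrB big_split /= !sumr_const card_ord -mulr_suml.
rewrite sum_pronic sum_maxn ?(ltnW (ltn_ord k)) //.
rewrite -[X in X + _ - _ - _]mulr_natr -[X in _ - X]mulr_natr.
by field.
Qed.

Lemma mpinv_tridiagB :
  mpinv (tridiagB R N) = \matrix_(j < N, k < N) neumann_green k j.
Proof.
apply: mpinv_unique (mpinvP _) _.
apply: (@is_mpinv_sym _ _ _ _ (const_mx N%:R^-1)).
- exact: tridiagB_sym.
- by apply/matrixP => j k; rewrite !mxE neumann_greenC.
- apply/matrixP => j k; rewrite !mxE -tridiagB_green.
  by apply: eq_bigr => l _; rewrite !mxE.
- exact: trmx_const.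
(* After transposition the rows of B act on a constant sequence, whose differences vanish. *)
- rewrite -[LHS]trmxK trmx_mul tridiagB_sym trmx_const.
  apply/matrixP => j k; rewrite !mxE.
  under eq_bigr do rewrite [const_mx _ _ _]mxE.
  by rewrite (tridiagB_apply (fun=> N%:R^-1)) !subrr !mulr0 subrr.
- apply/matrixP => j k; rewrite !mxE.
  under eq_bigr do rewrite !mxE.
  by rewrite -mulr_sumr sum_neumann_green mulr0.
Qed.

End Laplacian.

Theorem theorem2p5 (R : realType) (N : nat) (hN : (2 <= N)%N) :
  (mpinv (tridiagB R N))^T = mpinv (tridiagB R N) /\
  forall j k : 'I_N, (k <= j)%N ->
    mpinv (tridiagB R N) j k =
      - ((N%:R - 1) * (2 * N%:R - 1) / (6 * N%:R)) + j%:R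
      - j%:R * (j%:R + 1) / (2 * N%:R) - k%:R * (k%:R + 1) / (2 * N%:R).
Proof.
rewrite mpinv_tridiagB //; split.
  by apply/matrixP => j k; rewrite !mxE neumann_greenC.
by move=> j k kj; rewrite mxE /neumann_green (maxn_idPl kj).
Qed.
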